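(* For every integer $t \geq 2$, let $t_0$ be the largest integer with $2^{t_0} < t$. Then $\mathrm{ex}(\{M(K_t)\},n) = 2^n(1 - 2^{-t_0}) + 2^{t-2^{t_0}-1}-1$ for all sufficiently large $n$.
   Context: A matroid of dimension $m$ is a set $M \subseteq \mathbb{F}_2^m \setminus \{0\}$. A subset of $M \subseteq \mathbb{F}_2^m$ that is the image of $N \subseteq \mathbb{F}_2^k$ under an injective linear map $\mathbb{F}_2^k \to \mathbb{F}_2^m$ is an $N$-restriction of $M$; $M$ is $N$-free if it has no $N$-restriction. $\mathrm{ex}(\{N\},n)$ is the maximum size of an $n$-dimensional $N$-free matroid. For a simple graph $G = (V,E)$, $M(G) \subseteq \mathbb{F}_2^V$ is the matroid consisting of the columns of the $V \times E$ incidence matrix of $G$ over $\mathbb{F}_2$. $K_t$ is the complete graph on $t$ vertices. *)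

(* Defs.v *)
From HB Require Import structures.
From mathcomp Require Import all_boot all_order all_algebra.
From mathcomp Require Import boolp.

Set Implicit Arguments.
Unset Strict Implicit.
Unset Printing Implicit Defensive.

Import GRing.Theory.

Local Open Scope ring_scope.

Definition is_matroid (m : nat) (M : {set 'cV['F_2]_m}) : Prop :=
  0 \notin M.

Definition is_restriction (k m : nat) (N : {set 'cV['F_2]_k})
    (M S : {set 'cV['F_2]_m}) : Prop :=
  S \subset M /\
  exists f : {linear 'cV['F_2]_k -> 'cV['F_2]_m},
    injective f /\ S = [set f x | x in N].

Definition is_free (k m : nat) (N : {set 'cV['F_2]_k})
    (M : {set 'cV['F_2]_m}) : Prop :=
  ~ exists S : {set 'cV['F_2]_m}, is_restriction N M S.

(* The empty matroid is N-free as soon as N is nonempty, so in that case the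
   default value 0 of \max plays no role. *)
Definition ex_matroid (k : nat) (N : {set 'cV['F_2]_k}) (n : nat) : nat :=
  (\max_(M : {set 'cV['F_2]_n} | `[< is_matroid M /\ is_free N M >]) #|M|)%N.

Record sgraph (v : nat) := SGraph {
  edges : {set {set 'I_v}};
  edgesP : forall e, e \in edges -> #|e| = 2%N
}.

Definition incidence_mx (v : nat) (G : sgraph v) : 'M['F_2]_(v, #|edges G|) :=
  \matrix_(x < v, j < #|edges G|) (x \in enum_val j)%:R.

Definition graph_matroid (v : nat) (G : sgraph v) : {set 'cV['F_2]_v} :=
  [set col j (incidence_mx G) | j : 'I_#|edges G|].

Lemma graph_matroidP (v : nat) (G : sgraph v) : is_matroid (graph_matroid G).
Proof.
apply/imsetP => -[j _ /esym/matrixP h].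
have /edgesP e2 := enum_valP j.
have /card_gt0P[x xj] : (0 < #|enum_val j|)%N by rewrite e2.
by have := h x 0; rewrite !mxE xj => /eqP; rewrite oner_eq0.
Qed.

Lemma complete_edgesP (t : nat) (e : {set 'I_t}) :
  e \in [set e : {set 'I_t} | #|e| == 2%N] -> #|e| = 2%N.
Proof. by rewrite inE => /eqP. Qed.

Definition complete_graph (t : nat) : sgraph t :=
  SGraph (@complete_edgesP t).

(* Main.v *)
Require Import Defs.
From mathcomp Require Import all_boot all_order all_algebra.
From mathcomp Require Import boolp zify lra.

(* M contains M(K_t) iff there are linearly independent v_1, ..., v_t with all
   sums v_i + v_j (i <> j) in M. Put r = 2^t0 and s = t - r - 1.

   Lower bound: for subspaces S <= W of dimension s and codimension t0, the set
   ~W u (S \ 0) is free, because the v_i fall into at most r cosets of W, so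
   that their differences inside the cosets span at least s + 1 dimensions.

   Upper bound: let B be the complement of M, so |B| <= 2^n / r - 2^s. If M
   contains (X + U) \ U with |X| = 2r and U large, then it contains M(K_t), as
   one can pick independent vectors in t distinct cosets of U in X + U. Since
   dense sets contain cosets of large subspaces, (X, U) can be enlarged to
   (X u (y + X), U') as long as the set of v with v + X inside M is dense. Hence
   for |X| = r the translates of B by X almost tile the space, and starting from
   X = {0, z} shows that |B n (B + z)| is small for almost all z in M. Then B is
   almost closed under addition, so it is close to a subspace H, of codimension
   t0. As H \ B has at least 2^s elements, it contains independent
   w_0, ..., w_s; generic representatives x_0, ..., x_{r-1} of the cosets of H
   together with x_0 + w_0, ..., x_s + w_s are the vectors wanted. *)

Set Implicit Arguments.
Unset Strict Implicit.
Unset Printing Implicit Defensive.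

Import GRing.Theory.

Local Open Scope ring_scope.

(* Cardinals of the same set reached through different canonical structure
   paths are distinct atoms for [lia]; generalizing them identifies these. *)
Local Ltac card_lia := repeat (move: #|_| => ?); lia.

(** * Subgroups and translates in groups of exponent two *)

Section ElementaryAbelian.

Variable V : finZmodType.
Hypothesis addvv : forall x : V, x + x = 0.

Implicit Types (x y z u v : V) (A B M U X Y Z H W : {set V}).

(** Since [x = - x], this preimage is the translate [x + A]; likewise, an [addr_closed] set is a
    subgroup. *)
Definition shift x A : {set V} := [set y | x + y \in A].

Lemma addvK x : cancel (+%R x) (+%R x).
Proof. by move=> y; rewrite addrA addvv add0r. Qed.

Lemma card_shift x A : #|shift x A| = #|A|.
Proof.
rewrite -(card_imset A (can_inj (addvK x))).
apply: eq_card => y; rewrite inE; apply/idP/imsetP => [h|[z hz ->]].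
  by exists (x + y); rewrite ?addvK.
by rewrite addvK.
Qed.

(** Double counting: a pair [(a, b)] contributes only to [z = a + b]. *)
Lemma sum_card_shift A B : (\sum_z #|A :&: shift z B| = #|A| * #|B|)%N.
Proof.
have -> : (\sum_z #|A :&: shift z B| = \sum_z \sum_(a in A) (z + a \in B)%R)%N.
  apply: eq_bigr => z _; rewrite -sum1_card big_mkcond [RHS]big_mkcond /=.
  by apply: eq_bigr => a _; rewrite !inE; case: (a \in A); case: (_ \in B).
rewrite exchange_big /= -sum_nat_const; apply: eq_bigr => a _.
rewrite -(card_shift a B) -sum1_card [RHS]big_mkcond /=.
by apply: eq_bigr => z _; rewrite inE addrC; case: (_ \in B).
Qed.

Lemma addr_closed_double U z :
  addr_closed U -> z \notin U ->
  addr_closed (U :|: shift z U) /\ #|U :|: shift z U| = (2 * #|U|)%N.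
Proof.
move=> [U0 UD] zU; split; first split.
- by rewrite inE U0.
- move=> x y; rewrite !inE => /orP[hx|hx] /orP[hy|hy].
  + by rewrite UD.
  + by apply/orP; right; rewrite addrCA UD.
  + by apply/orP; right; rewrite addrA UD.
  + by have := UD _ _ hx hy; rewrite addrACA addvv add0r => ->.
rewrite cardsU card_shift (_ : U :&: shift z U = set0) ?cards0 ?subn0 ?mul2n ?addnn //.
apply/setP => x; rewrite !inE; apply/negP => /andP[hx hzx].
by case/negP: zU; have := UD _ _ hzx hx; rewrite -addrA addvv addr0.
Qed.

Lemma addr_closed_between U X k :
  addr_closed U -> addr_closed X -> U \subset X -> #|U| = (2 ^ k)%N ->
  forall l, (k <= l)%N -> (2 ^ l <= #|X|)%N ->
  exists Y, [/\ addr_closed Y, U \subset Y, Y \subset X & #|Y| = (2 ^ l)%N].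
Proof.
move=> cU cX UX Uk; elim=> [|l IH] kl lX.
  by exists U; split=> //; move: kl Uk; rewrite leqn0 => /eqP ->.
move: kl; rewrite leq_eqVlt => /orP[/eqP <-|kl]; first by exists U.
have [|Y [cY UY YX Yl]] := IH kl; first by rewrite (leq_trans _ lX) // leq_exp2l.
have /subsetPn[z zX zY] : ~~ (X \subset Y).
  by apply: contraL lX => /subset_leq_card; rewrite Yl -ltnNge => h; rewrite (leq_ltn_trans h) // ltn_exp2l.
have [cD cardD] := addr_closed_double cY zY.
exists (Y :|: shift z Y); split=> //.
- exact: subset_trans UY (subsetUl _ _).
- rewrite subUset YX; apply/subsetP => x; rewrite inE => /(subsetP YX) h.
  by rewrite -(addvK z x); case: cX => _; apply.
- by rewrite cardD Yl expnS.
Qed.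

Lemma addr_closed1 : addr_closed [set (0 : V)].
Proof.
split=> [|x y]; rewrite !inE // => /eqP-> /eqP->.
by rewrite addr0.
Qed.

Lemma card_addr_closed X : addr_closed X -> exists k, #|X| = (2 ^ k)%N.
Proof.
move=> cX; have X0 : [set 0] \subset X by rewrite sub1set; case: cX.
have Xgt0 : (0 < #|X|)%N by rewrite (leq_trans _ (subset_leq_card X0)) ?cards1.
have [Y [cY _ YX Yk]] := @addr_closed_between _ _ 0%N addr_closed1 cX X0 (cards1 _) _
  (leq0n _) (trunc_logP (leqnn 2) Xgt0).
exists (trunc_log 2 #|X|); rewrite -Yk; apply/eqP; rewrite eqn_leq (subset_leq_card YX) andbT.
(* If [Y] were proper, it could be doubled inside [X], beyond the largest power of two up to
   [#|X|]. *)
rewrite leqNgt; apply/negP => YltX.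
have /subsetPn[z zX zY] : ~~ (X \subset Y).
  by apply: contraL YltX => /subset_leq_card; rewrite -leqNgt.
have [_ cardD] := addr_closed_double cY zY.
have : (#|Y :|: shift z Y| <= #|X|)%N.
  apply: subset_leq_card; rewrite subUset YX; apply/subsetP => x.
  rewrite inE => /(subsetP YX) h.
  by rewrite -(addvK z x); case: cX => _; apply.
by rewrite cardD Yk -expnS leqNgt trunc_log_ltn.
Qed.

(** * Configurations and the translates of the complement *)

Lemma card_bigcup_le (I : Type) (r : seq I) (P : pred I) (F : I -> {set V}) :
  (#|\bigcup_(i <- r | P i) F i| <= \sum_(i <- r | P i) #|F i|)%N.
Proof.
elim/big_rec2: _ => [|i n C _ h]; first by rewrite cards0.
by rewrite (leq_trans (leq_card_setU _ _)) // leq_add2l.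
Qed.

(* M contains (X + U) \ U, and X + U is direct as soon as 0 is not in M. *)
Definition config M X U : Prop :=
  [/\ addr_closed X, addr_closed U &
      forall x u, x \in X -> x != 0 -> u \in U -> x + u \in M].

(** A coset [y + Y] inside it, with [Y] a subgroup of [U], lets [X] grow to [X :|: shift y X] while
    [U] shrinks to [Y]. *)
Definition transporter X M : {set V} := [set v | [forall x in X, x + v \in M]].

Lemma setC_transporter X M :
  ~: transporter X M = \bigcup_(x in X) shift x (~: M).
Proof.
apply/setP => v; rewrite !inE negb_forall_in; apply/exists_inP/bigcupP.
  by case=> x xX h; exists x => //; rewrite !inE.
by case=> x xX; rewrite !inE => h; exists x.
Qed.

Lemma card_transporter X M :
  (#|V| <= #|transporter X M| + #|X| * #|~: M|)%N.
Proof.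
rewrite -(cardsC (transporter X M)) leq_add2l setC_transporter.
rewrite (leq_trans (card_bigcup_le _ _ _)) // -sum_nat_const.
by apply: leq_sum => x _; rewrite card_shift.
Qed.

(** The union bound counts the intersection of the translates by [0] and [z] twice. *)
Lemma card_transporter2 X M z :
  0 \in X -> z \in X -> z != 0 ->
  (#|V| + #|~: M :&: shift z (~: M)| <= #|transporter X M| + #|X| * #|~: M|)%N.
Proof.
move=> X0 zX z0; rewrite -(cardsC (transporter X M)) -addnA leq_add2l.
rewrite setC_transporter (bigD1 0) //= (bigD1 z) /=; last by rewrite zX.
have -> : shift 0 (~: M) = ~: M by apply/setP => x; rewrite inE add0r.
set B := ~: M; set C := bigop _ _ _; rewrite setUA.
have hC : (#|C| <= (#|X| - 2) * #|B|)%N.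
  rewrite (leq_trans (card_bigcup_le _ _ _)) //.
  rewrite (eq_bigr (fun=> #|B|)); last by move=> x _; rewrite card_shift.
  rewrite sum_nat_const leq_mul2r; apply/orP; right.
  have -> : #|[pred x | (x \in X) && (x != 0) && (x != z)]| = #|X :\ 0 :\ z|.
    by apply: eq_card => x; rewrite !inE andbC [(x \in X) && _]andbC.
  have := cardsD1 0 X; have := cardsD1 z (X :\ 0).
  by rewrite !inE X0 zX z0 /= => h ->; rewrite h !add1n subn2.
have X2 : (2 <= #|X|)%N.
  have <- : #|[set 0; z]| = 2%N by rewrite cards2 eq_sym z0.
  by apply: subset_leq_card; apply/subsetP => x; rewrite !inE => /orP[]/eqP->.
have h1 : (#|B :|: shift z B :|: C| <= #|B :|: shift z B| + #|C|)%N := leq_card_setU _ _.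
have h2 := cardsUI B (shift z B); rewrite card_shift in h2.
have -> : (#|X| * #|B| = (#|X| - 2) * #|B| + 2 * #|B|)%N.
  by rewrite -mulnDl subnK.
move: hC h1 h2; card_lia.
Qed.

(** * Subgroups from sets almost closed under addition *)

(* If |W + W| < 3/2 |W|, every element of W + W has more than |W|/2
   representations, so any two of them have one with a common summand. *)
Lemma small_doubling W :
  (2 * #|[set (x + y)%R | x in W, y in W]| < 3 * #|W|)%N ->
  addr_closed [set x + y | x in W, y in W].
Proof.
set H := [set _ | x in W, y in W] => hW.
have rep z : z \in H -> (#|W| < 2 * #|W :&: shift z W|)%N.
  case/imset2P=> a b aW bW ->.
  have sub c : c \in W -> shift c W \subset H.
    move=> cW; apply/subsetP => x; rewrite inE => cxW.
    by apply/imset2P; exists c (c + x); rewrite ?addvK.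
  have h1 : (#|shift a W :|: shift b W| <= #|H|)%N.
    by apply: subset_leq_card; rewrite subUset !sub.
  have h2 := cardsUI (shift a W) (shift b W).
  have <- : #|shift b (shift a W :&: shift b W)| = #|W :&: shift (a + b) W|.
    by apply: eq_card => x; rewrite !inE addvK addrA andbC.
  by move: h1 h2 hW; rewrite !card_shift; card_lia.
have [w wW] : exists w, w \in W.
  by apply/set0Pn; apply: contraL hW => /eqP ->; rewrite cards0 muln0.
split; first by apply/imset2P; exists w w; rewrite ?addvv.
move=> x y xH yH; have h3 := rep x xH; have h4 := rep y yH.
have h1 := cardsUI (W :&: shift x W) (W :&: shift y W).
have h2 : (#|W :&: shift x W :|: W :&: shift y W| <= #|W|)%N.
  by apply: subset_leq_card; rewrite subUset !subsetIl.
have /set0Pn[a] : W :&: shift x W :&: (W :&: shift y W) != set0.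
  by rewrite -card_gt0; move: h1 h2 h3 h4; card_lia.
rewrite !inE => /andP[/andP[_ h] /andP[_ h']].
apply/imset2P; exists (x + a) (y + a) => //.
by rewrite addrACA addvv addr0.
Qed.

(** Triangle inequality: if [x + y] moves [b] out of [B], then [x] already does so, or [y] moves
    [x + b] out of [B]. *)
Lemma card_setD_shiftD B x y :
  (#|B :\: shift (x + y)%R B| <= #|B :\: shift x B| + #|B :\: shift y B|)%N.
Proof.
rewrite addnC -(card_shift x (B :\: shift y B)) addnC.
apply: leq_trans (leq_card_setU _ _); apply: subset_leq_card.
apply/subsetP => b; rewrite !inE -!addrA => /andP[h ->].
by rewrite andbT addrCA h /=; case: (_ \in B).
Qed.

(** [E] counts the pairs from [B] with sum outside [B]. Most of [B] lies in the set [W] of elements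
    moving less than a tenth of [B] out of [B]. By the triangle inequality, each element of [W + W]
    is a sum of two elements of [B] in at least [4/5 * #|B|] ways, so [W + W] is small enough for
    [small_doubling]. *)
Lemma almost_closed_subgroup B :
  (0 < #|B|)%N ->
  let E := (\sum_(x in ~: B) #|B :&: shift x B|)%N in
  (100 * E <= #|B| * #|B|)%N ->
  exists H, [/\ addr_closed H, (4 * #|H| <= 5 * #|B|)%N,
    (9 * #|B| <= 10 * #|H|)%N & (#|B :\: H| * #|B| <= 10 * E)%N].
Proof.
move=> Bgt0 E hE.
pose D x := #|B :\: shift x B|.
have DE x : (#|B :&: shift x B| + D x = #|B|)%N by rewrite cardsID.
have sumD : (\sum_(x in B) D x = E)%N.
  have := sum_card_shift B B; rewrite (bigID (mem B)) /=.
  have -> : (\sum_(i | i \notin B) #|B :&: shift i B| = E)%N.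
    by apply: eq_bigl => x; rewrite inE.
  rewrite -[X in _ = X]sum_nat_const -(eq_bigr _ (fun x _ => DE x)) big_split /=.
  by move/eqP; rewrite eqn_add2l => /eqP.
pose W := [set x | 10 * D x < #|B|]%N.
have hBW : (#|B :\: W| * #|B| <= 10 * E)%N.
  rewrite -sumD big_distrr -sum_nat_const /= [X in (_ <= X)%N](bigID (mem W)) /=.
  apply: leq_trans (leq_addl _ _).
  rewrite (eq_bigl (fun x => (x \in B) && (x \notin W))); last first.
    by move=> x; rewrite inE andbC.
  by apply: leq_sum => x /andP[_]; rewrite inE -leqNgt.
have hWB : (10 * #|B :\: W| <= #|B|)%N.
  rewrite -(leq_pmul2r Bgt0); apply: leq_trans hE.
  by rewrite -mulnA (_ : 100 = 10 * 10)%N // -mulnA leq_mul2l.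
have cW : (9 * #|B| <= 10 * #|W|)%N.
  have := cardsID W B; have := subset_leq_card (subsetIr B W); move: hWB; card_lia.
pose H := [set x + y | x in W, y in W].
have hH : (4 * #|H| <= 5 * #|B|)%N.
  rewrite -(leq_pmul2r Bgt0) -[X in (_ <= X)%N]mulnA -sum_card_shift.
  rewrite mulnAC mulnC big_distrr /= -sum_nat_const [X in (_ <= X)%N](bigID (mem H)) /=.
  apply: leq_trans (leq_addr _ _); apply: leq_sum => z /imset2P[x y xW yW zE].
  have := card_setD_shiftD B x y; rewrite -zE -/(D x) -/(D y) -/(D z).
  by move: xW yW (DE z); rewrite !inE; move: (D x) (D y) (D z) => dx dy dz; card_lia.
have W0 : 0 \in W.
  rewrite inE /D (_ : B :\: shift 0 B = set0) ?cards0 //.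
  by apply/setP => x; rewrite !inE add0r; case: (x \in B).
have WH : W \subset H.
  by apply/subsetP => x xW; apply/imset2P; exists x 0; rewrite ?addr0.
have cWH := subset_leq_card WH.
exists H; split=> //.
- by apply: small_doubling; rewrite -/H; move: Bgt0 cW hH cWH; card_lia.
- by move: cW cWH; card_lia.
- by apply: leq_trans hBW; rewrite leq_mul2r subset_leq_card ?orbT // setDS.
Qed.

End ElementaryAbelian.

(** * Cosets in dense sets and the growth of configurations *)

(* Intersecting A repeatedly with a translate of itself in a new direction
   squares the density up to a factor 2, by averaging over the direction. *)
Lemma dense_contains_coset q k : exists l, forall (V : finZmodType) (U A : {set V}),
  (forall x : V, x + x = 0) ->
  addr_closed U -> A \subset U -> (2 ^ l <= #|U|)%N -> (#|U| <= q * #|A|)%N ->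
  exists (z : V) (Y : {set V}), [/\ addr_closed Y, Y \subset U, #|Y| = (2 ^ k)%N, z \in A &
    {in Y, forall u, z + u \in A}].
Proof.
(* The induction needs many cosets: a proportion at least [1/p] of [U] consists of starting points
   [z]. *)
suff [l [p hl]] : exists l p, forall (V : finZmodType) (U A : {set V}),
  (forall x : V, x + x = 0) ->
  addr_closed U -> A \subset U -> (2 ^ l <= #|U|)%N -> (#|U| <= q * #|A|)%N ->
  exists Y : {set V}, [/\ addr_closed Y, Y \subset U, #|Y| = (2 ^ k)%N &
    (#|U| <= p * #|[set z in A | [forall u in Y, (z + u)%R \in A]]|)%N].
  exists l => V U A addvv cU AU Ul hq.
  have [Y [cY YU Yk hp]] := hl V U A addvv cU AU Ul hq.
  set A' := [set z in A | _] in hp.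
  have /set0Pn[z] : A' != set0.
    by apply: contraL hp => /eqP ->; rewrite cards0 muln0 -ltnNge (leq_trans _ Ul) ?expn_gt0.
  rewrite inE => /andP[zA /forall_inP hz].
  by exists z, Y.
elim: k => [|k [l [p IH]]].
  exists 0%N, q => V U A _ cU AU _ hq; exists [set 0]; split.
  - exact: addr_closed1.
  - by rewrite sub1set; case: cU.
  - by rewrite cards1.
  - apply: (leq_trans hq); rewrite leq_mul2l; apply/orP; right.
    apply: subset_leq_card; apply/subsetP => z zA; rewrite inE zA.
    by apply/forall_inP => u; rewrite inE => /eqP ->; rewrite addr0.
(* The size of [U] ensures that [A'] has more than [2 ^ k.+1] elements. *)
exists (l + (p * 2 ^ k.+1).+1)%N, (2 * p ^ 2)%N => V U A addvv cU AU Ul hq.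
have [|Y [cY YU Yk hp]] := IH V U A addvv cU AU _ hq.
  by rewrite (leq_trans _ Ul) // leq_exp2l // leq_addr.
set A' := [set z in A | _] in hp.
have A'U : A' \subset U.
  by apply: subset_trans AU; apply/subsetP => x; rewrite inE => /andP[].
have pU : (p * 2 ^ k.+1 < #|U|)%N.
  apply: leq_trans Ul; apply: (leq_trans (ltn_expl _ (leqnn 2))).
  by rewrite leq_exp2l //; lia.
have A'big : (2 ^ k.+1 < #|A'|)%N.
  move: (leq_trans pU hp); rewrite ltn_mul2l => /andP[_] //.
have [/exists_inP[z zUY hz]|] := boolP [exists z in U :\: Y,
    (#|U| <= 2 * p ^ 2 * #|A' :&: shift z A'|)%N].
  move: zUY; rewrite inE => /andP[zY zU].
  have [cD cardD] := addr_closed_double addvv cY zY.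
  exists (Y :|: shift z Y); split=> //.
  - rewrite subUset YU; apply/subsetP => x; rewrite inE => /(subsetP YU) h.
    by rewrite -(addvK addvv z x); case: cU => _; apply.
  - by rewrite cardD Yk expnS.
  - apply: (leq_trans hz); rewrite leq_mul2l; apply/orP; right.
    apply: subset_leq_card; apply/subsetP => a; rewrite !inE.
    move=> /andP[/andP[aA /forall_inP h1] /andP[zaA /forall_inP h2]].
    rewrite aA; apply/forall_inP => u; rewrite !inE => /orP[/h1//|/h2].
    by rewrite addrACA addvv add0r.
(* Among the pairs from [A'], less than half have their sum in [Y], at most half in [U :\: Y] by
   assumption, and none outside [U]. *)
rewrite negb_exists_in => /forall_inP hz; exfalso.
have := sum_card_shift addvv A' A'.
rewrite (bigID (mem Y)) /= [X in (_ + X)%N](bigID (mem U)) /=.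
set S1 := bigop _ _ _; set S2 := bigop _ _ _; set S3 := bigop _ _ _ => hsum.
have hS1 : (S1 <= 2 ^ k * #|A'|)%N.
  rewrite -Yk -sum_nat_const; apply: leq_sum => z _.
  exact: subset_leq_card (subsetIl _ _).
have hS3 : S3 = 0%N.
  apply: big1 => z /andP[_ zU]; apply/eqP; rewrite cards_eq0; apply/eqP/setP => a.
  rewrite !inE; apply/negP => /andP[ha hza]; case/negP: zU.
  have aU : a \in U by apply: (subsetP A'U); rewrite inE.
  have zaU : z + a \in U by apply: (subsetP A'U); rewrite inE.
  by case: cU => _ /(_ _ _ zaU aU); rewrite -addrA addvv addr0.
have hS2 : (2 * p ^ 2 * S2 <= #|U| * #|U|)%N.
  rewrite big_distrr /= -sum_nat_const big_mkcond /= [X in (_ <= X)%N]big_mkcond /=.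
  apply: leq_sum => z _; case: ifP => [/andP[zY zU]|_].
    by rewrite zU ltnW // ltnNge hz // inE zY.
  by case: ifP.
have p_gt0 : (0 < p)%N.
  by rewrite lt0n; apply: contraTneq (leq_trans pU hp) => ->.
have hS2' : (2 * S2 <= #|A'| * #|A'|)%N.
  rewrite -(@leq_pmul2l (p ^ 2)) ?expn_gt0 ?p_gt0 // mulnCA mulnA.
  by apply: (leq_trans hS2); rewrite expnS expn1 mulnACA leq_mul.
move: hsum hS1 hS2' A'big; rewrite hS3 addn0 expnS.
by move: #|A'| (2 ^ k)%N => a e; clear; nia.
Qed.

(** By averaging, some coset of [U] meets the transporter in a proportion at least [1/q], and
    [dense_contains_coset] applies inside it. *)
Lemma config_double q k : exists l, forall (V : finZmodType) (M X U : {set V}),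
  (forall x : V, x + x = 0) -> 0 \notin M -> config M X U ->
  (2 ^ l <= #|U|)%N -> (#|V| <= q * #|transporter X M|)%N ->
  exists X' U', [/\ config M X' U', X \subset X', #|X'| = (2 * #|X|)%N &
    #|U'| = (2 ^ k)%N].
Proof.
have [l hl] := dense_contains_coset q k.
exists l => V M X U addvv M0 [cX cU XU] Ul hq; set Z := transporter X M in hq.
have [/existsP[y hy]|] := boolP [exists y, #|U| <= q * #|U :&: shift y Z|]%N.
  have [z [Y [cY YU Yk _ hz]]] := hl V U _ addvv cU (subsetIl _ _) Ul hy.
  have hyz u x : u \in Y -> x \in X -> y + z + x + u \in M.
    move=> uY xX; have := hz u uY; rewrite !inE => /andP[_ /forall_inP/(_ x xX)].
    by rewrite addrCA !addrA [y + x + z]addrAC.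
  (* Otherwise [x = y + z] and [u = 0] would put [0] into [M]. *)
  have yzX : y + z \notin X.
    apply: contra M0 => yzX; have := hyz 0 (y + z).
    by rewrite addvv addr0; apply=> //; case: cY.
  have [cD cardD] := addr_closed_double addvv cX yzX.
  exists (X :|: shift (y + z) X), Y; split=> //; last exact: subsetUl.
  split=> // x u; rewrite !inE => /orP[xX|xX] x0 uY.
    by apply: XU => //; apply: (subsetP YU).
  by have := hyz u _ uY xX; rewrite (addvK addvv).
rewrite negb_exists => /forallP hy; exfalso.
have := sum_card_shift addvv U Z.
have Vgt0 : (0 < #|V|)%N by apply/card_gt0P; exists 0.
have : (\sum_(y : V) (q * #|U :&: shift y Z|).+1 <= \sum_(y : V) #|U|)%N.
  by apply: leq_sum => y _; rewrite ltnNge.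
rewrite (eq_bigr (fun y => (1 + q * #|U :&: shift y Z|)%N)) // big_split /=.
rewrite -big_distrr /= !sum_nat_const => h1 h2; rewrite h2 in h1.
have := leq_mul (leqnn #|U|) hq; move: h1 Vgt0; repeat (move: #|_| => ?); nia.
Qed.

(** Before each doubling the translates of [~: M] by [X] cover at most half of the space, so the
    transporter has density at least [1/2]. *)
Lemma config_iter j k : exists l, forall (V : finZmodType) (M X U : {set V}),
  (forall x : V, x + x = 0) -> 0 \notin M -> config M X U ->
  (2 ^ l <= #|U|)%N -> (2 ^ j * #|X| * #|~: M| <= #|V|)%N ->
  exists X' U', [/\ config M X' U', X \subset X', #|X'| = (2 ^ j * #|X|)%N &
    #|U'| = (2 ^ k)%N].
Proof.
elim: j => [|j [l1 IH]].
  exists k => V M X U addvv _ [cX cU XU] kU _.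
  have U0 : [set 0] \subset U by rewrite sub1set; case: cU.
  have [Y [cY _ YU Yk]] := @addr_closed_between _ addvv _ _ 0%N
    (addr_closed1 V) cU U0 (cards1 _) _ (leq0n _) kU.
  exists X, Y; split=> //; last by rewrite mul1n.
  by split=> // x u xX x0 /(subsetP YU); apply: XU.
have [l2 hd] := config_double 2 l1.
exists l2 => V M X U addvv M0 cXU Ul hB.
have [|X' [U' [cXU' XX' X'c U'c]]] := hd V M X U addvv M0 cXU Ul.
  have := card_transporter addvv X M.
  have : (2 * (#|X| * #|~: M|) <= #|V|)%N.
    apply: leq_trans hB; rewrite expnS -!mulnA leq_mul2l /=.
    by rewrite leq_pmull // expn_gt0.
  by repeat (move: #|_| => ?); nia.
have [||X2 [U2 [cXU2 XX2 X2c U2c]]] := IH V M X' U' addvv M0 cXU'.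
- by rewrite U'c.
- by rewrite X'c mulnA -expnSr.
exists X2, U2; split=> //; first exact: subset_trans XX2.
by rewrite X2c X'c mulnA -expnSr.
Qed.

(** * Structure of the complement *)

(* A popular difference z of the complement B of M gives {0, z} as a start for
   [config_iter], and then the translates of B by X overlap too much. *)
Lemma popular_differences_sparse t0 q k :
  exists l, forall (V : finZmodType) (M : {set V}),
  (forall x : V, x + x = 0) -> 0 \notin M -> (2 ^ l <= #|V|)%N ->
  (2 ^ t0 * #|~: M| <= #|V|)%N ->
  (forall X U, config M X U -> #|X| = (2 ^ t0.+1)%N -> #|U| = (2 ^ k)%N -> False) ->
  (q * #|V| < #|V| + q * (2 ^ t0 * #|~: M|))%N /\
  (q * #|[set x in M | #|V| <= q * #|~: M :&: shift x (~: M)|]| < #|V|)%N.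
Proof.
have [l1 hd] := config_double q k.
have [l2 hi] := config_iter t0 l1.
have [l3 hi'] := config_iter t0.-1 l1.
(* For [t0 = 0] the set [{0, z}] already has the forbidden size, so [Y] must have [2 ^ k] elements
   directly. *)
have [l4 ha] := dense_contains_coset q (if t0 is 0 then k else l3).
exists (maxn l2 l4) => V M addvv M0 Vl hB hX.
have small X U : config M X U -> #|X| = (2 ^ t0)%N -> #|U| = (2 ^ l1)%N ->
    (q * #|transporter X M| < #|V|)%N.
  move=> cXU Xc Uc; rewrite ltnNge; apply/negP => hq.
  have [|X' [U' [cXU' _ X'c U'c]]] := hd V M X U addvv M0 cXU _ hq.
    by rewrite Uc.
  by apply: (hX X' U'); rewrite // X'c Xc expnS.
have cT : addr_closed [set: V] by split=> [|x y _ _]; rewrite inE.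
split.
  have [||| X [U [cXU _ Xc Uc]]] := hi V M [set 0] setT addvv M0.
  - split=> //; first exact: addr_closed1.
    by move=> x u; rewrite inE => ->.
  - by rewrite cardsT (leq_trans _ Vl) // leq_exp2l // leq_maxl.
  - by rewrite cards1 muln1.
  rewrite cards1 muln1 in Xc.
  have := small X U cXU Xc Uc; have := card_transporter addvv X M; rewrite Xc.
  by move: (2 ^ t0)%N; repeat (move: #|_| => ?); nia.
rewrite ltnNge; apply/negP => hq; rewrite -cardsT in hq *.
have [|z [Y [cY _ Yc zM hz]]] := ha V setT _ addvv cT (subsetT _) _ hq.
  by rewrite cardsT (leq_trans _ Vl) // leq_exp2l // leq_maxr.
have zM' := zM; rewrite inE in zM'; case/andP: zM' => zinM zpop.
have z0 : z != 0 by apply: contraNneq M0 => <-.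
have cXY : config M [set 0; z] Y.
  split=> //; first split=> [|x y]; rewrite ?inE ?eqxx //.
    move=> /orP[]/eqP-> /orP[]/eqP->; rewrite ?addr0 ?add0r ?addvv ?eqxx ?orbT //.
  move=> x u; rewrite !inE => /orP[/eqP->|/eqP->]; first by rewrite eqxx.
  by move=> _ /hz; rewrite inE => /andP[].
have Xc : #|[set 0; z]| = 2%N by rewrite cards2 eq_sym z0.
case: t0 hB hX small hi hi' ha Yc => [|t0] hB hX small hi hi' ha Yc.
  exact: (hX _ _ cXY Xc Yc).
have [||X [U [cXU XX X'c U'c]]] := hi' V M _ Y addvv M0 cXY.
- by rewrite Yc.
- by rewrite Xc -expnSr.
rewrite Xc /= -expnSr in X'c.
(* Counted with multiplicity, the translates have at most [#|V|] elements, so what they miss is at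
   least as large as the popular overlap. *)
have := small X U cXU X'c U'c.
have := @card_transporter2 V addvv X M z.
rewrite !(subsetP XX) ?inE ?eqxx ?orbT // => /(_ isT isT z0); rewrite X'c.
move: hB zpop; rewrite cardsT; move: (2 ^ _)%N.
by repeat (move: #|_| => ?); nia.
Qed.

Lemma complement_near_subgroup t0 p k :
  (0 < p)%N ->
  exists l, forall (V : finZmodType) (M : {set V}),
  (forall x : V, x + x = 0) -> 0 \notin M -> (2 ^ l <= #|V|)%N ->
  (2 ^ t0 * #|~: M| <= #|V|)%N ->
  (forall X U, config M X U -> #|X| = (2 ^ t0.+1)%N -> #|U| = (2 ^ k)%N -> False) ->
  exists H : {set V}, [/\ addr_closed H, (2 ^ t0 * #|H| = #|V|)%N &
    (p * #|~: M :\: H| <= #|V|)%N].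
Proof.
move=> p_gt0; set r := (2 ^ t0)%N.
have r_gt0 : (0 < r)%N by rewrite expn_gt0.
(* The factor [800] makes [r * #|B|] almost [#|V|], [r * r] pays for replacing [#|V|] by [#|B|], and
   [p] survives into the final bound. *)
pose q := (800 * r * r * p)%N.
have [l hl] := popular_differences_sparse t0 q k.
exists l => V M addvv M0 Vl hB hX.
have [hBq hpop] := hl V M addvv M0 Vl hB hX; rewrite -/r in hB hBq.
set B := ~: M in hB hBq hpop *.
have Vgt0 : (0 < #|V|)%N by apply/card_gt0P; exists 0.
have q800 : (800 <= q)%N by rewrite /q; move: r_gt0 p_gt0; clear; nia.
have Bbig : (799 * #|V| < 800 * (r * #|B|))%N.
  by move: hBq q800 Vgt0; move: (q) (r * #|B|)%N; move: #|_| => b q' a; clear; nia.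
have Bgt0 : (0 < #|B|)%N by move: Bbig; case: #|B| => //; rewrite !muln0.
pose E := (\sum_(x in ~: B) #|B :&: shift x B|)%N.
(* Fewer than [#|V| / q] popular differences contribute at most [#|V|] each, every other element of
   [M] less than [#|V| / q]. *)
have qE : (q * E <= 2 * (#|V| * #|V|))%N.
  set P := [set x in M | _] in hpop.
  rewrite /E setCK (bigID (mem P)) /= mulnDr mul2n -addnn leq_add //.
    apply: (@leq_trans (q * (#|P| * #|V|))).
      rewrite leq_mul2l -sum_nat_const; apply/orP; right.
      rewrite [X in (X <= _)%N](eq_bigl (fun x => x \in P)); last first.
        by move=> x /=; rewrite inE; case: (x \in M).
      by apply: leq_sum => x _; apply: max_card.
    by rewrite mulnA leq_mul2r ltnW ?orbT.
  rewrite big_distrr /=; apply: (@leq_trans (\sum_(x : V) #|V|)).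
    rewrite big_mkcond /=; apply: leq_sum => x _; case: ifP => // /andP[xM].
    by rewrite inE xM /= -ltnNge => /ltnW.
  by rewrite sum_nat_const.
have E100 : (100 * E <= #|B| * #|B|)%N.
  have h : (#|V| * #|V| <= 4 * (r * r * (#|B| * #|B|)))%N.
    by move: Bbig; move: #|B| #|V|; clear => b v; nia.
  have {}h : (r * r * (800 * E) <= r * r * (8 * (#|B| * #|B|)))%N.
    apply: (@leq_trans (q * E)).
      by rewrite mulnA [(_ * 800)%N]mulnC !mulnA leq_mul2r leq_pmulr ?orbT.
    apply: (leq_trans qE); rewrite mulnCA.
    by move: h; card_lia.
  by move: h; rewrite leq_pmul2l ?muln_gt0 ?r_gt0 //; move: (E) => e; card_lia.
have [H [cH H1 H2 H3]] := almost_closed_subgroup addvv Bgt0 E100.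
exists H; split=> //.
  (* Both orders are powers of two, and [r * #|H|] lies strictly between [#|V| / 2] and
     [2 * #|V|]. *)
  have [n Vn] : exists n, #|V| = (2 ^ n)%N.
    have [|n hn] := @card_addr_closed V addvv setT; last by exists n; rewrite -cardsT.
    by split=> [|x y _ _]; rewrite inE.
  have [h Hh] := card_addr_closed addvv cH.
  have lt1 : (2 ^ (t0 + h) < 2 ^ n.+1)%N.
    rewrite expnD expnS -Vn -Hh -/r; move: H1 hB Vgt0.
    by repeat (move: #|_| => ?); clear; nia.
  have lt2 : (2 ^ n < 2 ^ (t0 + h).+1)%N.
    rewrite expnS expnD -Vn -Hh -/r; move: H2 Bbig.
    by repeat (move: #|_| => ?); clear; nia.
  rewrite ltn_exp2l // in lt1; rewrite ltn_exp2l // in lt2.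
  by rewrite Hh Vn -expnD; congr (2 ^ _)%N; lia.
rewrite -/E in H3.
have h1 : (q * (#|B :\: H| * #|B|) <= 20 * (#|V| * #|V|))%N.
  by move: H3 qE; move: (E) (q) => e q'; repeat (move: #|_| => ?); clear; nia.
have h2 : (#|V| <= 2 * (r * #|B|))%N by move: Bbig; lia.
have h3 : (400 * r * p * #|B :\: H| * #|V| <= 20 * #|V| * #|V|)%N.
  apply: leq_trans (leq_trans _ h1) _; last by rewrite mulnA.
  apply: (leq_trans (leq_mul (leqnn _) h2)); rewrite /q.
  by move: #|_| #|_|; clear; nia.
rewrite leq_pmul2r // in h3.
by move: h3 r_gt0; repeat (move: #|_| => ?); clear; nia.
Qed.

(** * Independent vectors over F_2 and copies of M(K_t) *)

Lemma F2_cases (a : 'F_2) : a = 0 \/ a = 1.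
Proof. by case: a => [[|[|m]]] // lt; [left|right]; apply/val_inj. Qed.

Lemma addvv2 n (x : 'cV['F_2]_n) : x + x = 0.
Proof.
apply/matrixP => i j; rewrite !mxE.
by have [->|->] := F2_cases (x i j); apply/val_inj.
Qed.

Lemma card_cV2 n : #|{: 'cV['F_2]_n}| = (2 ^ n)%N.
Proof. by rewrite card_mx card_Fp // muln1. Qed.

Lemma graph_matroid_completeP t (x : 'cV['F_2]_t) :
  reflect (exists i j : 'I_t, i != j /\ x = delta_mx i 0 + delta_mx j 0)
    (x \in graph_matroid (complete_graph t)).
Proof.
have pairE (i j k : 'I_t) : i != j ->
    (k \in [set i; j])%:R = (k == i)%:R + (k == j)%:R :> 'F_2.
  move=> ij; rewrite !inE; case: (eqVneq k i) => [->|_]; last by rewrite add0r.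
  by rewrite (negPf ij) addr0.
apply: (iffP imsetP) => [[e _ ->]|[i [j [ij ->]]]].
  have /eqP/cards2P[i [j [ij eE]]] := edgesP (enum_valP e).
  exists i, j; split=> //; apply/matrixP => k l.
  by rewrite !mxE eE pairE // [l]ord1 eqxx !andbT.
have ijE : [set i; j] \in edges (complete_graph t) by rewrite inE cards2 ij.
exists (enum_rank_in ijE [set i; j]) => //; apply/matrixP => k l.
by rewrite !mxE enum_rankK_in // pairE // [l]ord1 eqxx !andbT.
Qed.


Lemma clique_not_free t n (M : {set 'cV['F_2]_n}) (s : t.-tuple 'cV['F_2]_n) :
  free s -> (forall i j : 'I_t, i != j -> s`_i + s`_j \in M) ->
  ~ is_free (graph_matroid (complete_graph t)) M.
Proof.
move=> /freeP fs sM; apply; pose A := \matrix_(k < n, i < t) s`_i k 0.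
have AE (x : 'cV_t) : A *m x = \sum_(i < t) x i 0 *: s`_i.
  apply/matrixP => k l; rewrite !mxE summxE; apply: eq_bigr => i _.
  by rewrite !mxE [l]ord1 mulrC.
have Ad i : A *m delta_mx i 0 = s`_i.
  rewrite AE (bigD1 i) //= big1 => [|j ji]; rewrite mxE eqxx ?eqxx.
    by rewrite scale1r addr0.
  by rewrite (negPf ji) scale0r.
exists [set A *m x | x in graph_matroid (complete_graph t)]; split.
  apply/subsetP => y /imsetP[x /graph_matroid_completeP[i [j [ij ->]]] ->].
  by rewrite mulmxDr !Ad sM.
exists (mulmx A); split=> // x y /eqP; rewrite -subr_eq0 -mulmxBr AE => /eqP/fs h.
apply/eqP; rewrite -subr_eq0; apply/eqP/matrixP => i j; rewrite [j]ord1.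
by rewrite h mxE.
Qed.

Lemma card_span2 n (s : seq 'cV['F_2]_n) :
  (#|[set v | v \in <<s>>%VS]| <= 2 ^ size s)%N.
Proof.
pose f (c : {ffun 'I_(size s) -> 'F_2}) := \sum_i c i *: (in_tuple s)`_i.
apply: (@leq_trans #|[set f c | c in setT]|).
  apply: subset_leq_card; apply/subsetP => v; rewrite inE => vs; apply/imsetP.
  exists [ffun i => coord (in_tuple s) i v]; rewrite ?inE //.
  by rewrite [LHS](coord_span (X := in_tuple s)) //; apply: eq_bigr => i _; rewrite ffunE.
by rewrite (leq_trans (leq_imset_card _ _)) // cardsT card_ffun card_Fp // card_ord.
Qed.

(** Greedy choice: the next vector avoids the translates of [F] by the [i] chosen ones and the span
    of these and [ws]. *)
Lemma pick_free n (G F : {set 'cV['F_2]_n}) ws m :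
  free ws ->
  (forall i, (i < m)%N -> (i * #|F| + 2 ^ (i + size ws) < #|G|)%N) ->
  exists s, [/\ size s = m, {subset s <= G}, free (s ++ ws) &
    pairwise (fun x y => x + y \notin F) s].
Proof.
move=> fws; elim: m => [|m IH] hm; first by exists [::].
have [|s [sm sG fs ps]] := IH; first by move=> i im; apply: hm; apply: ltnW.
pose C := \bigcup_(y <- s) shift y F; pose S := [set v | v \in <<s ++ ws>>%VS].
have cC : (#|C| <= m * #|F|)%N.
  rewrite (leq_trans (card_bigcup_le _ _ _)) //.
  rewrite (eq_bigr (fun=> #|F|)); last by move=> y _; rewrite card_shift //; apply: addvv2.
  by rewrite big_const_seq count_predT iter_addn_0 sm mulnC.
have cS : (#|S| <= 2 ^ (m + size ws))%N by rewrite -sm -size_cat card_span2.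
have /subsetPn[v vG] : ~~ (G \subset C :|: S).
  apply/negP => /subset_leq_card GCS; have := hm m (leqnn _).
  by rewrite ltnNge (leq_trans GCS) // (leq_trans (leq_card_setU _ _)) // leq_add.
rewrite inE negb_or => /andP[vC]; rewrite inE => vS.
exists (v :: s); split.
- by rewrite /= sm.
- by move=> x; rewrite inE => /orP[/eqP->|/sG].
- by rewrite cat_cons free_cons vS.
rewrite /= ps andbT; apply/allP => y ys; apply: contra vC => vyF.
by rewrite /C (big_rem y ys) /= !inE addrC vyF.
Qed.

Lemma config_not_free t n (M X U : {set 'cV['F_2]_n}) :
  0 \notin M -> config M X U -> (t <= #|X|)%N -> #|U| = (2 ^ t)%N ->
  ~ is_free (graph_matroid (complete_graph t)) M.
Proof.
move=> M0 [cX cU XU] tX Ut.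
have XUM x x' u u' : x \in X -> x' \in X -> u \in U -> u' \in U -> x != x' ->
    x + u + (x' + u') \in M.
  move=> xX x'X uU u'U xx'; rewrite addrACA; apply: XU.
  - by case: cX => _; apply.
  - apply: contra_neq xx' => xx'0; rewrite -(addvK (@addvv2 n) x' x) [x' + x]addrC.
    by rewrite xx'0 addr0.
  - by case: cU => _; apply.
pose G := [set x + u | x in X, u in U].
have cG : #|G| = (#|X| * #|U|)%N.
  rewrite -cardsX /G curry_imset2X; apply: card_in_imset => -[x u] [x' u'].
  rewrite !inE /= => /andP[xX uU] /andP[x'X u'U] e.
  have [xx'|xx'] := eqVneq x x'; first by move: e; rewrite xx' => /addrI ->.
  by have := XUM _ _ _ _ xX x'X uU u'U xx'; rewrite e addvv2 (negPf M0).
have [|s [st sG]] := @pick_free n G U [::] t (nil_free _).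
  move=> i it; rewrite addn0 cG (@leq_trans (i.+1 * #|U|)) //.
    by rewrite mulSn addnC ltn_add2r Ut ltn_exp2l.
  by rewrite leq_mul2r (leq_trans it) ?orbT.
rewrite cats0 => fs /(pairwiseP 0) ps; rewrite st in ps.
have sM i j : (i < j)%N -> (j < t)%N -> s`_i + s`_j \in M.
  move=> ij jt; have it := ltn_trans ij jt.
  have /imset2P[x u xX uU E] : s`_i \in G by apply: sG; rewrite mem_nth ?st.
  have /imset2P[x' u' x'X u'U E'] : s`_j \in G by apply: sG; rewrite mem_nth ?st.
  have := ps i j it jt ij; rewrite E E'.
  have [->|xx' _] := eqVneq x x'; last exact: XUM.
  rewrite addrACA addvv2 add0r => /negP[].
  by case: cU => _; apply.
have /eqP sz := st; apply: (@clique_not_free t n M (Tuple sz)) => // i j ij /=.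
have [lt|lt|eq] := ltngtP i j; first exact: sM.
- by rewrite addrC; apply: sM.
- by case/eqP: ij; apply: val_inj.
Qed.

(** * Upper bound *)

Lemma dense_not_free t t0 : (2 ^ t0 < t <= 2 ^ t0.+1)%N ->
  exists n0, forall n (M : {set 'cV['F_2]_n}), (n0 <= n)%N -> 0 \notin M ->
  (2 ^ n + 2 ^ (t - 2 ^ t0 - 1) <= #|M| + 2 ^ (n - t0))%N ->
  ~ is_free (graph_matroid (complete_graph t)) M.
Proof.
set r := (2 ^ t0)%N; set s := (t - r - 1)%N => /andP[rt tr].
have r_gt0 : (0 < r)%N by rewrite expn_gt0.
have tE : t = (r + s.+1)%N by rewrite /s; lia.
have sr : (s.+1 <= r)%N by move: tr; rewrite expnS -/r; lia.
(* Chosen so that the exceptional set [E] below has at most [h / (2 * r)] elements. *)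
pose p := (2 * r * r * 2 ^ t)%N.
have p_gt0 : (0 < p)%N by rewrite !muln_gt0 r_gt0 expn_gt0.
have [l hl] := complement_near_subgroup t0 t p_gt0.
exists (maxn l (t0 + t).+2) => n M; rewrite geq_max => /andP[ln tn] M0 hM Mfree.
have cV := card_cV2 n.
have VE : (2 ^ n = r * 2 ^ (n - t0))%N by rewrite -expnD subnKC //; lia.
set B := ~: M; set N := (2 ^ n)%N in hM cV VE; set h := (2 ^ (n - t0))%N in hM VE.
have cMB : (#|M| + #|B| = N)%N by rewrite cardsC cV.
have Bh : (#|B| + 2 ^ s <= h)%N by move: cMB hM; card_lia.
have [||X U cXU Xc Uc|H [cH Hc BH]] := hl _ M (@addvv2 n) M0.
- by rewrite cV leq_exp2l.
- by rewrite cV VE leq_mul2l (leq_trans _ Bh) ?orbT // leq_addr.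
- by apply: (config_not_free M0 cXU _ Uc Mfree); rewrite Xc.
rewrite -/B cV in BH; rewrite cV VE -/r in Hc.
have {}Hc : #|H| = h by apply/eqP; rewrite -(eqn_pmul2l r_gt0) Hc.
(* Adding [0] makes the count exceed [2 ^ s] strictly; a free family never contains [0], so [ws]
   lies in [H :\: B]. *)
have [|ws [wss wsG fws _]] := @pick_free n (0 |: (H :\: B)) set0 [::] s.+1 (nil_free _).
  move=> i i_s; rewrite cards0 muln0 add0n addn0 cardsU1 !inE M0 /= add1n ltnS.
  apply: (@leq_trans (2 ^ s)); first by rewrite leq_exp2l.
  by have := cardsID B H; have := subset_leq_card (subsetIr H B); move: Bh; rewrite Hc; card_lia.
rewrite cats0 in fws.
have wsP w : w \in ws -> w \in H :\: B.
  by move=> ww; have := wsG w ww; rewrite in_setU1 (negPf (free_not0 fws ww)).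
pose S := [set w | w \in <<ws>>%VS].
have cS : (#|S| <= 2 ^ s.+1)%N by rewrite -wss card_span2.
(* The vectors that some element of [S] moves into [B] outside [H]. *)
pose E := \bigcup_(w in S) shift w (B :\: H).
have cE : (#|E| <= 2 ^ t * #|B :\: H|)%N.
  rewrite (leq_trans (card_bigcup_le _ _ _)) //.
  rewrite (eq_bigr (fun=> #|B :\: H|)); last by move=> y _; rewrite card_shift //; apply: addvv2.
  rewrite sum_nat_const leq_mul2r (leq_trans cS) ?orbT // leq_exp2l //; lia.
have [|xs [xss _ fxs /(pairwiseP 0) pxs]] := @pick_free n setT (H :|: E) ws r fws.
  move=> i ir; rewrite cardsT cV wss.
  have cF : (#|H :|: E| <= h + #|E|)%N by rewrite -Hc leq_card_setU.
  have h1 : (2 ^ (i + s.+1) <= 2 ^ t)%N by rewrite leq_exp2l // tE leq_add2r ltnW.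
  have h2 : (2 * (r * (r * #|E|)) <= r * h)%N.
    rewrite -VE; apply: leq_trans BH; rewrite /p -!mulnA !leq_mul2l cE !orbT //.
  have h3 : (2 * 2 ^ t < h)%N by rewrite -expnS ltn_exp2l //; lia.
  rewrite mulnCA leq_pmul2l // in h2.
  apply: leq_ltn_trans (leq_add (leq_mul (leqnn i) cF) h1) _.
  rewrite VE; move: h2 h3; move: #|E| (h) (2 ^ t)%N ir; clear => e h c ir h2 h3.
  have : (i * e <= r * e)%N by rewrite leq_mul2r ltnW ?orbT.
  have : (i.+1 * h <= r * h)%N by rewrite leq_mul2r ir orbT.
  lia.
rewrite xss in pxs.
(* The vectors [v k] are the representatives [xs] for [k < r], and [xs] plus [ws] termwise from
   [k = r] on. *)
pose c k := (if k < r then k else k - r)%N.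
pose e k : 'cV['F_2]_n := if (k < r)%N then 0 else ws`_(k - r).
have eS k : (k < t)%N -> e k \in S.
  rewrite inE /e => kt; case: ltnP => rk; first exact: mem0v.
  by apply: memv_span; rewrite mem_nth // wss; lia.
have cr k : (k < t)%N -> (c k < r)%N.
  rewrite /c => kt; case: (ltnP k r) => // rk.
  by rewrite ltn_subLR // (leq_trans kt) // tE leq_add2l.
have SD w w' : w \in S -> w' \in S -> w + w' \in S by rewrite !inE; apply: rpredD.
have SH w : w \in S -> w \in H.
  rewrite inE => wS.
  rewrite (coord_span (X := in_tuple ws) wS); case: (cH) => H0 HD.
  apply: (big_ind (fun x => x \in H)) => // i _.
  have wH : (in_tuple ws)`_i \in H.
    by have := wsP _ (mem_nth 0 (ltn_ord i)); rewrite inE => /andP[].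
  by have [->|->] := F2_cases (coord (in_tuple ws) i w); rewrite ?scale0r ?scale1r.
pose v k := xs`_(c k) + e k.
have vM i j : (i < j)%N -> (j < t)%N -> v i + v j \in M.
  move=> ij jt; have it := ltn_trans ij jt; rewrite /v addrACA.
  have [cij|cij] := eqVneq (c i) (c j).
    rewrite cij addvv2 add0r /e.
    have [ir jr] : (i < r)%N /\ (r <= j)%N.
      by move: cij; rewrite /c; case: (ltnP i r); case: (ltnP j r); lia.
    rewrite ir ltnNge jr /= add0r.
    have /wsP : ws`_(j - r) \in ws by rewrite mem_nth // wss; lia.
    by rewrite !inE negbK => /andP[].
  have : xs`_(c i) + xs`_(c j) \notin H :|: E.
    have [lt|lt|eq] := ltngtP (c i) (c j); last by rewrite eq eqxx in cij.
    - by apply: pxs; rewrite ?inE ?cr.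
    - by rewrite addrC; apply: pxs; rewrite ?inE ?cr.
  set x := xs`_(c i) + _; set w := e i + _ => xHE.
  have wS : w \in S by apply: SD; apply: eS.
  (* If [x + w] is in [B], then either it lies in [H], hence so does [x], or [x] lies in [E]. *)
  apply: contraR xHE => xwM; rewrite inE.
  have [xwH|xwH] := boolP (x + w \in H).
    apply/orP; left; have := SH w wS; case: cH => _ HD wH.
    by have := HD _ _ xwH wH; rewrite -addrA addvv2 addr0.
  apply/orP; right; apply/bigcupP; exists w => //.
  by rewrite !inE addrC xwH.
pose vs := mkseq v t.
have vss : size vs == t by rewrite size_mkseq.
apply: (@clique_not_free t n M (Tuple vss)) Mfree => [|i j ij] /=; last first.
  rewrite !nth_mkseq //; have [lt|lt|eq] := ltngtP i j; first exact: vM.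
  - by rewrite addrC; apply: vM.
  - by case/eqP: ij; apply: val_inj.
(* The [t] vectors are independent because they span the [t] independent vectors [xs ++ ws]. *)
rewrite /free size_mkseq eqn_leq -{1}(eqP vss) dim_span /=.
have -> : t = \dim <<xs ++ ws>>.
  by move: fxs; rewrite /free => /eqP ->; rewrite size_cat xss wss.
apply: dimvS; apply/span_subvP => x.
have vS k : (k < t)%N -> v k \in <<vs>>%VS.
  by move=> kt; apply: memv_span; apply/mapP; exists k; rewrite ?mem_iota.
have xsS k : (k < r)%N -> xs`_k \in <<vs>>%VS.
  move=> kr; have := vS k (ltn_trans kr rt).
  by rewrite /v /c /e kr addr0.
rewrite mem_cat => /orP[] /(nthP 0)[k].
  by rewrite xss => kr <-; apply: xsS.
rewrite wss => ks <-; have krt : (r + k < t)%N by rewrite tE ltn_add2l.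
have := vS _ krt; rewrite /v /c /e ltnNge leq_addr /= addKn => h1.
have := rpredB h1 (xsS k (leq_trans ks sr)).
by rewrite addrAC subrr add0r.
Qed.

(** * Lower bound *)

Lemma free_extremal t t0 n : (2 ^ t0 < t)%N -> (t0 + t <= n)%N ->
  exists M : {set 'cV['F_2]_n}, [/\ 0 \notin M,
    is_free (graph_matroid (complete_graph t)) M &
    (#|M| + 2 ^ (n - t0) + 1 = 2 ^ n + 2 ^ (t - 2 ^ t0 - 1))%N].
Proof.
set r := (2 ^ t0)%N; set s := (t - r - 1)%N => rt tn.
have cV := card_cV2 n.
have cT : addr_closed [set: 'cV['F_2]_n] by split=> [|x y _ _]; rewrite inE.
have [|| S [cS S0 _ Sc]] := @addr_closed_between _ (@addvv2 n) _ _ 0%N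
  (addr_closed1 _) cT (subsetT _) (cards1 _) s.
- by [].
- by rewrite cardsT cV leq_exp2l // /s; lia.
have [|| W [cW SW _ Wc]] := @addr_closed_between _ (@addvv2 n) _ _ s
  cS cT (subsetT _) Sc (n - t0).
- by rewrite /s; lia.
- by rewrite cardsT cV leq_exp2l // leq_subr.
rewrite sub1set in S0.
exists (~: W :|: S :\ 0); split.
- by rewrite !inE eqxx orbF negbK; case: cW.
- case=> T [TM [f [finj TE]]].
  have fM (i j : 'I_t) : i != j ->
      f (delta_mx i 0) + f (delta_mx j 0) \in ~: W :|: S :\ 0.
    move=> ij; rewrite -raddfD /=; apply: (subsetP TM); rewrite TE imset_f //.
    by apply/graph_matroid_completeP; exists i, j.
  pose d i : 'cV['F_2]_n := f (delta_mx i 0).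
  have fS (i j : 'I_t) : d i + d j \in W -> d i + d j \in S.
    have [->|ij] := eqVneq i j; first by rewrite addvv2.
    by move=> h; have := fM i j ij; rewrite -/(d i) -/(d j) !inE h /= => /andP[].
  (* The least index whose vector lies in the same coset of [W]. *)
  pose rep (i : 'I_t) : 'I_t := [arg min_(j < i | d i + d j \in W) j].
  have W0 : 0 \in W by case: cW.
  have repP i : d i + d (rep i) \in W.
    by rewrite /rep; case: arg_minnP => //; rewrite addvv2.
  have WD x y : x \in W -> y \in W -> x + y \in W by case: cW => _; apply.
  have rep_eq i j : d i + d j \in W -> rep i = rep j.
    move=> ijW; apply: val_inj; apply/eqP; rewrite eqn_leq /rep.
    case: arg_minnP; rewrite ?addvv2 // => i' ii' imin.
    case: arg_minnP; rewrite ?addvv2 // => j' jj' jmin.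
    apply/andP; split.
      apply: imin; have := WD _ _ ijW jj'.
      by rewrite addrA -[d i + d j + d j]addrA addvv2 addr0.
    apply: jmin; have := WD _ _ ijW ii'.
    by rewrite [d i + d j]addrC addrA -[d j + d i + d i]addrA addvv2 addr0.
  (* The vectors indexed by [R] lie in distinct cosets of [W], of which there are [r]. *)
  pose R := [set i | rep i == i].
  have cR : (#|R| <= r)%N.
    have : (#|R| * #|W| <= 2 ^ n)%N.
      rewrite -cardsX -cV -(card_in_imset (f := fun p => d p.1 + p.2)) ?max_card //.
      move=> [i w] [j w']; rewrite !inE /= => /andP[/eqP iR wW] /andP[/eqP jR w'W] e.
      have ijW : d i + d j \in W.
        by rewrite -[d i + d j]addr0 -(addvv2 w) addrACA e addrACA addvv2 add0r WD.
      have ij : i = j by rewrite -iR -jR; apply: rep_eq.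
      by move: e; rewrite ij => /addrI ->.
    rewrite Wc (_ : 2 ^ n = r * 2 ^ (n - t0))%N; last by rewrite -expnD subnKC //; lia.
    by rewrite leq_pmul2r // expn_gt0.
  (* Each term maps to a sum inside one coset of [W], hence into [S]. For [Q] disjoint from [R] the
     coordinates outside [R] recover [Q], so [S] would have at least [2 ^ s.+1] elements. *)
  pose g (Q : {set 'I_t}) : 'cV['F_2]_t := \sum_(j in Q) (delta_mx j 0 + delta_mx (rep j) 0).
  have gS Q : f (g Q) \in S.
    rewrite raddf_sum; case: (cS) => S0' SD; apply: (big_ind (fun x => x \in S)) => // i _.
    by rewrite raddfD /=; apply: fS.
  have repR j : rep j \in R.
    by rewrite inE; apply/eqP; apply: rep_eq; rewrite addrC.
  have gE Q k : k \notin R -> g Q k 0 = (k \in Q)%:R.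
    move=> kR; rewrite summxE (eq_bigr (fun j => (k == j)%:R)); last first.
      move=> j _; rewrite !mxE eqxx !andbT (_ : (k == rep j) = false) ?addr0 //.
      by apply: contraNF kR => /eqP ->.
    rewrite big_mkcond (bigD1 k) //= big1 ?addr0 => [|j /negPf jk].
      by rewrite eqxx; case: (k \in Q).
    by rewrite eq_sym jk if_same.
  have : (#|powerset (~: R)| <= #|S|)%N.
    rewrite -(card_in_imset (f := fun Q => f (g Q))).
      by apply: subset_leq_card; apply/subsetP => x /imsetP[Q _ ->].
    move=> Q Q'; rewrite !inE => QR Q'R /finj gQ; apply/setP => k.
    have [kR|kR] := boolP (k \in R).
      have notin (P : {set 'I_t}) : P \subset ~: R -> (k \in P) = false.
        by move=> /subsetP/(_ k) h; apply/negP => /h; rewrite inE kR.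
      by rewrite !notin.
    have := gE Q k kR; rewrite gQ gE //.
    by case: (k \in Q); case: (k \in Q').
  rewrite card_powerset Sc leq_exp2l //.
  by have := cardsC R; rewrite card_ord; move: cR; rewrite /s; card_lia.
have [h1 h2] : #|~: W :|: S :\ 0| = (#|~: W| + #|S :\ 0%R|)%N /\ #|S| = (1 + #|S :\ 0%R|)%N.
  split; last by rewrite (cardsD1 0 S) S0.
  apply/eqP; rewrite eqn_leq leq_card_setU /= -cardsUI (_ : _ :&: _ = set0).
    by rewrite cards0 addn0.
  by apply/setP => x; rewrite !inE; case: (boolP (x \in S)) => [/(subsetP SW) ->|_]; rewrite ?andbF.
have := cardsC W; rewrite cV; move: h1 h2; rewrite Sc Wc -/s.
by repeat (move: #|_| => ?); move: (2 ^ _)%N (2 ^ _)%N (2 ^ _)%N; lia.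
Qed.

Theorem theorem1p6 (t t0 : nat) (ht : (2 <= t)%N)
    (ht0 : (2 ^ t0 < t)%N)
    (ht0_max : forall s : nat, (2 ^ s < t)%N -> (s <= t0)%N) :
  exists n0 : nat, forall n : nat, (n0 <= n)%N ->
    (ex_matroid (graph_matroid (complete_graph t)) n)%:R =
      2 ^+ n * (1 - 2 ^- t0) + 2 ^+ (t - 2 ^ t0 - 1)%N - 1 :> rat.
Proof.
have tle : (t <= 2 ^ t0.+1)%N by rewrite leqNgt; apply/negP => /ht0_max; rewrite ltnn.
have [|n0 upper] := @dense_not_free t t0; first by rewrite ht0.
exists (maxn n0 (t0 + t)) => n; rewrite geq_max => /andP[n0n tn].
have [M [M0 Mfree Mc]] := free_extremal ht0 tn.
suff -> : ex_matroid (graph_matroid (complete_graph t)) n = #|M|.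
  have /(congr1 (fun k => k%:R : rat)) := Mc; rewrite !natrD !natrX => McQ.
  have nE : 2 ^+ n * 2 ^- t0 = 2 ^+ (n - t0) :> rat.
    by rewrite expfB_cond ?pnatr_eq0 //=; lia.
  by rewrite mulrBr mulr1 nE; move: McQ; lra.
apply/eqP; rewrite eqn_leq; apply/andP; split; last first.
  by apply: leq_bigmax_cond; apply/asboolP.
apply/bigmax_leqP => M' /asboolP[M'0 M'free]; rewrite leqNgt; apply/negP => MM'.
by apply: (upper n M' n0n M'0 _ M'free); move: MM' Mc; card_lia.
Qed.
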